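(* Let $V$ be a finite set and let $\mathcal{A}$, $\mathcal{B}$ be families of subsets of $V$ such that $|A \cap B| \le 1$ holds for all $A \in \mathcal{A}$ and $B \in \mathcal{B}$. Then $|\mathcal{A}| \cdot |\mathcal{B}| \le (|V|+1)\, 2^{|V|}$.
   Context: A family of subsets of $V$ is a set of subsets of $V$ (no repetitions). *)

(* Defs.v *)
From mathcomp Require Export all_boot.

(* Main.v *)
Require Import Defs.
From mathcomp Require Import all_boot.
From mathcomp Require Import zify.

(** Call two points adjacent when some member of [cA] contains both. Every member
of [cA] is then a clique, and every member of [cB] is independent, since it
shares at most one point with each member of [cA]. So it is enough to bound the
number [c] of cliques times the number [i] of independent sets of a graph on
[n] vertices by [(n + 1) 2 ^ n].

Induct on [n]: delete a vertex [v], leaving [S] with [n] vertices, and let [P]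
and [Q] be the neighbours and the non-neighbours of [v] in [S]. Then
[c <= c(S) + c(P)] and [i <= i(S) + i(Q)]. In the expanded product,
[c(S) i(S) <= (n + 1) 2 ^ n] by induction and [c(P) i(Q) <= 2 ^ |P| 2 ^ |Q| = 2 ^ n],
while [c(P) i(S) <= c(P) i(P) 2 ^ |Q| <= (|P| + 1) 2 ^ n] and symmetrically
[c(S) i(Q) <= (|Q| + 1) 2 ^ n]; these add up to [(n + 2) 2 ^ n.+1]. *)

Section Cliques.

Variable V : finType.
Implicit Types (e : rel V) (S T : {set V}) (v : V).

(** An arbitrary relation is allowed, so that independent sets are the cliques of the negated
    relation. *)
Definition cliques e S : {set {set V}} :=
  [set A : {set V} | (A \subset S) &&
     [forall x in A, forall y in A, (x != y) ==> e x y]].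

Lemma cliquesP e S (A : {set V}) :
  reflect (A \subset S /\ {in A &, forall x y, x != y -> e x y})
          (A \in cliques e S).
Proof.
rewrite inE; apply: (iffP andP) => [] [sAS cA]; split=> //.
  move=> x y Ax Ay nxy.
  by move/forall_inP/(_ x Ax)/forall_inP/(_ y Ay)/implyP: cA; apply.
apply/forall_inP=> x Ax; apply/forall_inP=> y Ay; apply/implyP.
exact: cA.
Qed.

Lemma sub_clique e S T (A B : {set V}) :
  A \in cliques e S -> B \subset A -> B \subset T -> B \in cliques e T.
Proof.
case/cliquesP=> _ cA /subsetP sBA sBT; apply/cliquesP; split=> // x y Bx By.
by apply: cA; apply: sBA.
Qed.

Lemma card_cliques_leq e S : #|cliques e S| <= 2 ^ #|S|.
Proof.
rewrite -card_powerset; apply/subset_leq_card/subsetP=> A /cliquesP[sAS _].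
by rewrite powersetE.
Qed.

(** A clique through [v] is determined by its other points, which are all neighbours of [v]. *)
Lemma card_cliquesU1 e v S :
  #|cliques e (v |: S)| <=
    #|cliques e S| + #|cliques e (S :&: [set y | e v y])|.
Proof.
set N := [set y | e v y].
apply: (@leq_trans
  #|cliques e S :|: [set v |: A | A in cliques e (S :&: N)]|); last first.
  by apply: (leq_trans (leq_card_setU _ _)); rewrite leq_add2l leq_imset_card.
apply/subset_leq_card/subsetP=> A clA; have [sAS cA] := cliquesP _ _ _ clA.
rewrite inE; have [Av | Av] := boolP (v \in A); apply/orP; last first.
  left; apply: sub_clique clA _ _ => //; apply/subsetP=> x Ax.
  have := subsetP sAS x Ax; case/setU1P=> // xv.
  by rewrite -xv Ax in Av.
right; apply/imsetP; exists (A :\ v); last by rewrite setD1K.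
apply: sub_clique clA (subsetDl _ _) _; apply/subsetP=> x /setD1P[nxv Ax].
rewrite !inE (cA v x) 1?eq_sym // andbT.
by have := subsetP sAS x Ax; rewrite !inE (negPf nxv).
Qed.

(** A clique is the union of its traces on [S] and [T], and the first is again a clique. *)
Lemma card_cliquesU e S T :
  #|cliques e (S :|: T)| <= #|cliques e S| * 2 ^ #|T|.
Proof.
rewrite -card_powerset -cardsX.
apply: (leq_trans _ (leq_imset_card (fun p => p.1 :|: p.2) _)).
apply/subset_leq_card/subsetP=> A clA; have [sA _] := cliquesP _ _ _ clA.
apply/imsetP; exists (A :&: S, A :&: T) => /=.
  rewrite inE /= powersetE subsetIr andbT.
  by apply: sub_clique clA _ _; rewrite ?subsetIl ?subsetIr.
by rewrite -setIUr; apply/esym/setIidPl.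
Qed.

Lemma cliques_independent_leq e S :
  #|cliques e S| * #|cliques (fun x y => ~~ e x y) S| <=
    (#|S| + 1) * 2 ^ #|S|.
Proof.
set f := fun x y => ~~ e x y.
(* Strong induction, as the bound is also needed on [P] and [Q]. *)
have [n] := ubnP #|S|; elim: n S => // n IHn S leSn.
have [-> | [v Sv]] := set_0Vmem S.
  have c0 g := card_cliques_leq g set0.
  by have := leq_mul (c0 e) (c0 f); rewrite cards0.
have cS : #|S| = #|S :\ v|.+1 by rewrite (cardsD1 v) Sv.
rewrite -(setD1K Sv) cardsU1 setD11 add1n.
(* From here on [S] stands for the old [S] without [v]. *)
move: (S :\ v) cS leSn => {Sv}S -> leSn.
set P := S :&: [set y | e v y]; set Q := S :&: [set y | f v y].
have QE : Q = S :\: [set y | e v y].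
  by apply/setP=> y; rewrite !inE andbC.
have SE : P :|: Q = S by rewrite QE setID.
have cPQ : #|P| + #|Q| = #|S| by rewrite QE cardsID.
have IHS := IHn S leSn.
have IHP := IHn P ltac:(lia).
have IHQ := IHn Q ltac:(lia).
have cU := card_cliquesU1 e v S.
have iU := card_cliquesU1 f v S.
have := card_cliquesU f P Q; rewrite SE => iSP.
have := card_cliquesU e Q P; rewrite setUC SE => cSQ.
have cPiQ := leq_mul (card_cliques_leq e P) (card_cliques_leq f Q).
apply: (leq_trans (leq_mul cU iU)); rewrite -/P -/Q mulnDl !mulnDr.
have cPiS : #|cliques e P| * #|cliques f S| <= (#|P| + 1) * 2 ^ #|S|.
  apply: (leq_trans (leq_mul (leqnn _) iSP)).
  by rewrite mulnA -cPQ expnD mulnA leq_mul2r IHP orbT.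
have cSiQ : #|cliques e S| * #|cliques f Q| <= (#|Q| + 1) * 2 ^ #|S|.
  apply: (leq_trans (leq_mul cSQ (leqnn _))).
  by rewrite mulnAC -cPQ (addnC #|P|) expnD mulnA leq_mul2r IHQ orbT.
rewrite -expnD cPQ in cPiQ.
apply: (leq_trans (leq_add (leq_add IHS cSiQ) (leq_add cPiS cPiQ))).
rewrite -cPQ expnS; lia.
Qed.

End Cliques.

Theorem mainTheorem3 (V : finType) (cA cB : {set {set V}})
    (hAB : forall A B : {set V}, A \in cA -> B \in cB -> #|A :&: B| <= 1) :
  #|cA| * #|cB| <= (#|V| + 1) * 2 ^ #|V|.
Proof.
pose e (x y : V) := [exists A in cA, (x \in A) && (y \in A)].
rewrite -cardsT; apply: leq_trans (cliques_independent_leq V e setT).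
apply: leq_mul; apply/subset_leq_card/subsetP=> A AcX;
  apply/cliquesP; split=> [|x y Ax Ay nxy]; rewrite ?subsetT //.
  by apply/exists_inP; exists A; rewrite ?Ax.
(* Here [A] is in [cB]; an edge inside it gives a [B] in [cA] that shares both [x] and [y] with
   [A]. *)
apply/exists_inP=> -[B BcA /andP[Bx By]].
have /card_le1_eqP/(_ x y) := hAB B A BcA AcX.
by rewrite !inE Ax Ay Bx By => /(_ isT isT) xy; rewrite xy eqxx in nxy.
Qed.
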